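(* For every simple undirected graph $G$ on $n\ge 2$ vertices, with complement $\overline{G}$, $$\alpha(G)+\alpha(\overline{G})\ge 1,$$ or equivalently, $$\beta(G)-\alpha(G)\le n-1.$$
   Context: Graphs are finite, undirected, unweighted and simple. For a graph $G$ on $n$ vertices, its Laplacian matrix is $L=D-A$, where $A$ is the adjacency matrix of $G$ and $D$ is the diagonal matrix of vertex degrees. The eigenvalues of $L$, counted with multiplicity, are denoted $0=\mu_n(G)\le\mu_{n-1}(G)\le\cdots\le\mu_1(G)$. Set $\alpha(G)=\mu_{n-1}(G)$ (the second smallest Laplacian eigenvalue, called the algebraic connectivity) and $\beta(G)=\mu_1(G)$ (the largest Laplacian eigenvalue). *)

(* Defs.v *)
From mathcomp Require Import all_boot all_order all_algebra.
From mathcomp Require Import polyrcf complex.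
From mathcomp Require Import reals.

Set Implicit Arguments.
Unset Strict Implicit.
Unset Printing Implicit Defensive.

Import Order.TTheory GRing.Theory Num.Theory.
Local Open Scope ring_scope.

Record sgraph (V : finType) := SGraph {
  adj : rel V;
  adj_sym : symmetric adj;
  adj_irr : irreflexive adj
}.

Definition compl_adj (V : finType) (G : sgraph V) : rel V :=
  fun x y => (x != y) && ~~ adj G x y.

Lemma compl_adj_sym (V : finType) (G : sgraph V) : symmetric (compl_adj G).
Proof. by move=> x y; rewrite /compl_adj eq_sym adj_sym. Qed.

Lemma compl_adj_irr (V : finType) (G : sgraph V) : irreflexive (compl_adj G).
Proof. by move=> x; rewrite /compl_adj eqxx. Qed.

Definition complement (V : finType) (G : sgraph V) : sgraph V :=
  SGraph (compl_adj_sym G) (compl_adj_irr G).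

Definition degree (V : finType) (G : sgraph V) (x : V) : nat :=
  #|[set y | adj G x y]|.

(* In the matrices below, row or column i : 'I_#|V| stands for the vertex
   [enum_val i]. *)
Definition adjacency_mx (R : realType) (V : finType) (G : sgraph V) :
    'M[R]_#|V| :=
  \matrix_(i, j) (adj G (enum_val i) (enum_val j))%:R.

Definition degree_mx (R : realType) (V : finType) (G : sgraph V) :
    'M[R]_#|V| :=
  diag_mx (\row_i (degree G (enum_val i))%:R).

Definition laplacian (R : realType) (V : finType) (G : sgraph V) :
    'M[R]_#|V| :=
  degree_mx R G - adjacency_mx R G.

(* Real eigenvalues in nonincreasing order, each repeated according to its
   multiplicity as a root of the characteristic polynomial.  For a symmetric
   matrix these are all the eigenvalues: see [char_poly_eigenvalues]. *)
Definition eigenvalues (R : rcfType) (n : nat) (A : 'M[R]_n) : seq R :=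
  let p := char_poly A in
  sort >=%R (flatten [seq nseq (mup x p) x | x <- rootsR p]).

(* [mu R G k] is the k-th largest Laplacian eigenvalue, 1 <= k <= #|V|. *)
Definition mu (R : realType) (V : finType) (G : sgraph V) (k : nat) : R :=
  (eigenvalues (laplacian R G))`_k.-1.

Definition alpha (R : realType) (V : finType) (G : sgraph V) : R :=
  mu R G #|V|.-1.

Definition beta (R : realType) (V : finType) (G : sgraph V) : R := mu R G 1.

Lemma char_poly_conj (F : fieldType) (n : nat) (P D : 'M[F]_n) :
  P \in unitmx -> char_poly (invmx P *m D *m P) = char_poly D.
Proof.
move=> uP; rewrite /char_poly.
have PK : map_mx polyC (invmx P) *m map_mx polyC P = 1%:M.
  by rewrite -map_mxM mulVmx // map_mx1.
have -> : char_poly_mx (invmx P *m D *m P)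
    = map_mx polyC (invmx P) *m char_poly_mx D *m map_mx polyC P.
  rewrite /char_poly_mx !map_mxM mulmxBr mulmxBl; congr (_ - _).
  by rewrite scalar_mxC -mulmxA PK mulmx1.
by rewrite !det_mulmx mulrAC -det_mulmx PK det1 mul1r.
Qed.

Lemma symmetric_char_poly_split (R : rcfType) (n : nat) (A : 'M[R]_n) :
  A^T = A -> exists s : seq R, char_poly A = \prod_(x <- s) ('X - x%:P).
Proof.
move=> symA; pose B := map_mx (real_complex R) A.
have hermB : B \is hermsymmx.
  apply: realsym_hermsym.
    by apply/is_hermitianmxP; rewrite expr0 scale1r map_mx_id // map_trmx symA.
  by apply/mxOverP => i j; rewrite mxE; apply/complex_realP; exists (A i j).
have /mxOverP dreal := hermitian_spectral_diag_real hermB.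
have /orthomx_spectralP eqB := hermitian_normalmx hermB.
exists [seq complex.Re (spectral_diag B 0 i) | i <- enum 'I_n].
apply: (@map_poly_inj _ _ (real_complex R)).
rewrite map_char_poly -/B {1}eqB char_poly_conj ?spectral_unit //.
rewrite char_poly_trig ?diag_mx_is_trig // rmorph_prod big_map big_enum /=.
apply: eq_bigr => i _.
by rewrite rmorphB /= map_polyX map_polyC /= RRe_real // !mxE eqxx.
Qed.

Lemma char_poly_eigenvalues (R : rcfType) (n : nat) (A : 'M[R]_n) :
  A^T = A -> char_poly A = \prod_(x <- eigenvalues A) ('X - x%:P).
Proof.
move=> /symmetric_char_poly_split[s eqs].
have p0 : char_poly A != 0 by rewrite monic_neq0 ?char_poly_monic.
rewrite [LHS]eqs; apply: perm_big; rewrite perm_sym /eigenvalues perm_sort.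
apply: perm_trans (perm_count_undup s).
under eq_map => x do rewrite eqs mu_prod_XsubC.
apply/perm_flatten/perm_map/uniq_perm; rewrite ?undup_uniq ?uniq_roots // => x.
have := roots_on_rootsR p0 x; rewrite in_itv /= => <-.
by rewrite mem_undup eqs root_prod_XsubC.
Qed.

Lemma size_eigenvalues (R : rcfType) (n : nat) (A : 'M[R]_n) :
  A^T = A -> size (eigenvalues A) = n.
Proof.
move=> /char_poly_eigenvalues/(congr1 (fun p : {poly R} => size p)).
by rewrite size_char_poly size_prod_XsubC => -[].
Qed.

Lemma laplacian_sym (R : realType) (V : finType) (G : sgraph V) :
  (laplacian R G)^T = laplacian R G.
Proof.
rewrite /laplacian linearB /= tr_diag_mx; congr (_ - _).
by apply/matrixP => i j; rewrite !mxE adj_sym.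
Qed.

(* Main.v *)
(** Let [l], [l'] be the algebraic connectivities of [G] and its complement,
    with non-constant eigenvectors [x], [y] rescaled to have range in [0, 1],
    the values 1 and 0 being attained by [x] at [v], [w] and by [y] at [v'], [w'].
    Subtracting the eigenvector equations of [x] at [v] and [w] writes [l] as a
    sum of nonnegative terms, and shows that [l >= 1] as soon as [v] and [w] are
    adjacent or have a common neighbour; likewise for [l'] in the complement.
    Otherwise [v], [v'], [w'], [w] induce a path on four vertices, up to the
    exchange of [v'] and [w'].  Then one adds the equations of [x] at [v] - [w]
    and at [v'] - [w'] to those of [y] at [v'] - [w'] and at [w] - [v].  If
    [l + l' < 1], every vertex outside the path contributes a nonnegative amount
    to the sum, and the four vertices of the path contribute too much. *)
Require Import Defs.
From mathcomp Require Import all_boot all_order all_algebra.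
From mathcomp Require Import reals.
From mathcomp Require Import lra polyrcf complex.
Import Order.TTheory GRing.Theory Num.Theory.
Local Open Scope ring_scope.

Set Implicit Arguments.
Unset Strict Implicit.

(** * The Laplacian acting on functions, and rescaled eigenvectors *)

Definition lap (R : realFieldType) (V : finType) (e : rel V) (x : V -> R)
    (i : V) : R :=
  \sum_j (x i - x j) *+ e i j.

(* The eigenvector equation modulo constants: unlike the equation itself, it is
   stable under adding a constant to [x] and under passing to the complement. *)
Definition lap_eigen (R : realFieldType) (V : finType) (e : rel V)
    (x : V -> R) (l : R) : Prop :=
  forall i j, lap e x i - lap e x j = l * (x i - x j).

Definition unit_range (R : realFieldType) (V : finType) (x : V -> R)
    (v w : V) : Prop :=
  [/\ x v = 1, x w = 0 & forall j, 0 <= x j <= 1].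

Lemma unit_rangeC (R : realFieldType) (V : finType) (x : V -> R) (v w : V) :
  unit_range x v w -> unit_range (fun j => 1 - x j) w v.
Proof.
move=> [xv xw x01]; split; rewrite ?xv ?xw ?subrr ?subr0 // => j.
by have := x01 j; lra.
Qed.

Lemma lap_eigenC (R : realFieldType) (V : finType) (e : rel V) (x : V -> R)
    (l c : R) :
  lap_eigen e x l -> lap_eigen e (fun j => c - x j) l.
Proof.
have lapC i : lap e (fun j => c - x j) i = - lap e x i.
  rewrite /lap -sumrN; apply: eq_bigr => j _; rewrite -mulNrn.
  by congr (_ *+ _); lra.
by move=> ex i j; rewrite !lapC; have := ex i j; lra.
Qed.

(** Subtract the minimum of [x] and divide by its range; the equation modulo constants survives
    both. *)
Lemma normalize_range (R : realFieldType) (V : finType) (e : rel V)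
    (x : V -> R) (l : R) (p q : V) :
  lap_eigen e x l -> x p != x q ->
  exists y v w, lap_eigen e y l /\ unit_range y v w.
Proof.
move=> ex xpq.
have [v _ xv] := @arg_maxP _ _ V p xpredT x isT.
have [w _ xw] := @arg_minP _ _ V p xpredT x isT.
have D0 : 0 < x v - x w.
  move: (xv p isT) (xv q isT) (xw p isT) (xw q isT) => /=.
  by case/lt_total/orP: xpq; lra.
pose y j := (x j - x w) / (x v - x w).
have yB i j : y i - y j = (x i - x j) / (x v - x w).
  by rewrite /y -mulrBl; congr (_ * _); lra.
exists y, v, w; split.
  have lapy i : lap e y i = lap e x i / (x v - x w).
    by rewrite /lap mulr_suml; apply: eq_bigr => j _; rewrite yB mulrnAl.
  by move=> i j; rewrite !lapy -mulrBl ex yB mulrA.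
split; first by rewrite /y divff // gt_eqF.
  by rewrite /y subrr mul0r.
move=> j; rewrite /y ler_pdivlMr // ler_pdivrMr //.
by move: (xv j isT) (xw j isT) => /=; lra.
Qed.

(** * Lower bounds on an eigenvalue from the extremes of its eigenvector *)

Section Extremes.
Variables (R : realFieldType) (V : finType) (e : rel V) (x : V -> R) (l : R).
Variables v w : V.
Hypotheses (ex : lap_eigen e x l) (xvw : unit_range x v w).

Lemma extremes_sum : l = \sum_j ((1 - x j) *+ e v j + x j *+ e w j).
Proof.
have [xv xw _] := xvw.
have := ex v w; rewrite xv xw subr0 mulr1 => <-; rewrite /lap -sumrB.
by apply: eq_bigr => j _; rewrite xv xw sub0r mulNrn opprK.
Qed.

Lemma extremes_term_ge0 j : 0 <= (1 - x j) *+ e v j + x j *+ e w j.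
Proof.
have [_ _ /(_ j)/andP[x0 x1]] := xvw.
by rewrite addr_ge0 // mulrn_wge0 // subr_ge0.
Qed.

Lemma extremes_ge0 : 0 <= l.
Proof.
by rewrite extremes_sum sumr_ge0 // => j _; exact: extremes_term_ge0.
Qed.

Lemma extremes_ge_term k : (1 - x k) *+ e v k + x k *+ e w k <= l.
Proof.
rewrite extremes_sum (bigD1 k) //= lerDl sumr_ge0 // => j _.
exact: extremes_term_ge0.
Qed.

Lemma extremes_ge_pair p q : p != q -> e v p -> e w q -> 1 - x p + x q <= l.
Proof.
move=> pq vp wq; rewrite extremes_sum (bigD1 p) //= (bigD1 q) 1?eq_sym //=.
have : 0 <= \sum_(j | (j != p) && (j != q))
    ((1 - x j) *+ e v j + x j *+ e w j).
  by apply: sumr_ge0 => j _; exact: extremes_term_ge0.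
have [_ _ x01] := xvw; have /andP[? ?] := x01 p; have /andP[? ?] := x01 q.
rewrite vp wq !mulr1n; have : 0 <= x p *+ e w p by rewrite mulrn_wge0.
have : 0 <= (1 - x q) *+ e v q by rewrite mulrn_wge0 // subr_ge0.
by lra.
Qed.

(** A single term of [extremes_sum] suffices: the one at [w] equals 1 if [v] and [w] are adjacent,
    and the one at a common neighbour [c] is [(1 - x c) + x c]. *)
Lemma extremes_ge1 : e v w \/ (exists c, e v c && e w c) -> 1 <= l.
Proof.
have [xv xw x01] := xvw.
case=> [vw|[c /andP[vc wc]]].
  apply: le_trans (extremes_ge_term w); rewrite vw xw subr0 lerDl.
  by rewrite mul0rn.
by apply: le_trans (extremes_ge_term c); rewrite vc wc !mulr1n; lra.
Qed.

End Extremes.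

(** * The path on four vertices *)

Lemma lap_eigen_path4 (R : realFieldType) (V : finType) (G : sgraph V)
    (x y : V -> R) (l l' : R) (v w v' w' : V) :
  lap_eigen (adj G) x l -> lap_eigen (adj (complement G)) y l' ->
  unit_range x v w -> unit_range y v' w' ->
  ~~ adj G v w -> (forall c, ~~ (adj G v c && adj G w c)) ->
  ~~ adj (complement G) v' w' ->
  (forall c, ~~ (adj (complement G) v' c && adj (complement G) w' c)) ->
  adj G v v' -> 1 <= l + l'.
Proof.
set e := adj G; set f := adj (complement G).
have fE i j : f i j = (i != j) && ~~ e i j by [].
have eC i j : e i j = e j i by rewrite /e adj_sym.
have e0 i : e i i = false by rewrite /e adj_irr.
move=> ex ey xvw yvw vwN Nvw v'w'N Nv'w' vv'.
have fC i j : f i j = f j i by rewrite /f adj_sym.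
have f0 i : f i i = false by rewrite /f adj_irr.
have neq i j : e i j -> i != j by apply: contraTneq => ->; rewrite e0.
have [xv xw x01] := xvw; have [yv yw y01] := yvw.
(* The hypotheses force the induced path [v], [v'], [w'], [w] in [G], hence the path [v'], [w], [v],
   [w'] in the complement. *)
have vw : v != w by apply: contraNneq (oner_neq0 R) => E; rewrite -xv E xw.
have vw' : v' != w' by apply: contraNneq (oner_neq0 R) => E; rewrite -yv E yw.
have v'w' : e v' w' by move: v'w'N; rewrite fE vw' /= negbK.
have wv'N : e w v' = false by have := Nvw v'; rewrite vv' => /negbTE.
have wv' : w != v' by apply: contraNneq vwN => ->.
have ww'n : w != w'.
  by apply: contraTneq v'w' => <-; rewrite eC wv'N.
have ww' : e w w'.
  have := Nv'w' w; rewrite !fE ![_ == w]eq_sym wv' ww'n /=.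
  by rewrite negb_and !negbK eC wv'N eC.
have vw'N : e v w' = false by have := Nvw w'; rewrite ww' andbT => /negbTE.
have vw'n : v != w' by apply: contraTneq ww' => <-; rewrite eC.
(* Drops of [x] and of [y] along the end edges of the two paths; the middle edges have drops
   [1 - a - b] and [1 - a' - b']. *)
set a := 1 - x v'; set b := x w'; set a' := y v; set b' := 1 - y w.
have fv'w : f v' w by rewrite fE eq_sym wv' eC wv'N.
have fw'v : f w' v by rewrite fE eq_sym vw'n eC vw'N.
have ab : a + b <= l by apply: extremes_ge_pair ex xvw _ _ vw' vv' ww'.
have ab' : a' + b' <= l'.
  rewrite addrC; apply: extremes_ge_pair ey yvw _ _ _ fv'w fw'v.
  by rewrite eq_sym.
have /andP[a0 a1] : 0 <= a <= 1 by have := x01 v'; rewrite /a; lra.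
have /andP[b0 b1] := x01 w' : 0 <= b <= 1.
have /andP[a'0 a'1] := y01 v : 0 <= a' <= 1.
have /andP[b'0 b'1] : 0 <= b' <= 1 by have := y01 w; rewrite /b'; lra.
rewrite leNgt; apply/negP => l1.
have sum_x : \sum_j ((x v' - x j) *+ e v' j - (x w' - x j) *+ e w' j)
    = l * (1 - a - b).
  rewrite sumrB -/(lap e x v') -/(lap e x w') ex.
  by congr (_ * _); rewrite /a /b; lra.
have sum_y : \sum_j ((y w - y j) *+ f w j - (y v - y j) *+ f v j)
    = l' * (1 - a' - b').
  rewrite sumrB -/(lap f y w) -/(lap f y v) ey.
  by congr (_ * _); rewrite /a' /b'; lra.
(* Contribution of the vertex [j] to the sum of the four equations. *)
pose tau j := ((1 - x j) *+ e v j + x j *+ e w j)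
  + ((x v' - x j) *+ e v' j - (x w' - x j) *+ e w' j)
  + ((1 - y j) *+ f v' j + y j *+ f w' j)
  + ((y w - y j) *+ f w j - (y v - y j) *+ f v j).
have sum_tau : \sum_j tau j
    = l + l * (1 - a - b) + l' + l' * (1 - a' - b').
  rewrite -sum_x -sum_y {1}(extremes_sum ex xvw).
  by rewrite {1}(extremes_sum ey yvw) -!big_split.
(* On each path the end edges cancel and the middle edge is counted twice. *)
have tau4 : tau v + (tau w + (tau v' + tau w'))
    = (1 - a - b) *+ 2 + (1 - a' - b') *+ 2.
  have eE := (e0, negbTE vwN, vv', vw'N, wv'N, ww', v'w').
  have fE' := (fC w v, fC v' v, fC w' v, fC v' w, fC w' w, fC w' v').
  rewrite /tau !fE' (eC w v) (eC v' v) (eC w' v) (eC v' w) (eC w' w) (eC w' v').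
  rewrite !fE !eE !eqxx vw vw'n wv' /= ?andbF ?mulr1n ?mulr0n ?mulr2n.
  by rewrite xv xw yv yw /a /b /a' /b'; lra.
(* Nine adjacency patterns remain: [j] misses [v] or [w], and meets [v'] or [w']. Each follows from
   [ab], [ab'] and [l + l' < 1]. *)
have tau_ge0 j : j != v -> j != w -> j != v' -> j != w' -> 0 <= tau j.
  rewrite ![j == _]eq_sym => jv jw jv' jw'.
  have := Nvw j; have := Nv'w' j; rewrite /tau !fE jv jw jv' jw' /=.
  have /andP[xj0 xj1] := x01 j; have /andP[yj0 yj1] := y01 j.
  have -> : x v' = 1 - a by rewrite /a; lra.
  have -> : y w = 1 - b' by rewrite /b'; lra.
  by case: (e v j); case: (e w j); case: (e v' j); case: (e w' j) => //= _ _;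
    rewrite ?mulr1n ?mulr0n -/a' -/b; lra.
have tau_le : tau v + (tau w + (tau v' + tau w')) <= \sum_j tau j.
  rewrite (bigD1 v) // (bigD1 w) 1?eq_sym //= (bigD1 v') /=; last first.
    by rewrite ![v' == _]eq_sym wv' (neq _ _ vv').
  rewrite (bigD1 w') /=; last by rewrite ![w' == _]eq_sym vw' vw'n ww'n.
  rewrite !lerD2l lerDl sumr_ge0 // => j /andP[/andP[/andP[jv jw] jv'] jw'].
  exact: tau_ge0.
move: tau_le; rewrite sum_tau tau4 !mulr2n => tau_le.
(* As [1 - a - b >= 1 - l] and [1 - a' - b' >= 1 - l'], the bound gives
   [4 - 4 (l + l') + l ^+ 2 + l' ^+ 2 <= 0]. *)
have : 0 <= (2 - l) * (l - (a + b)) by apply: mulr_ge0; lra.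
have : 0 <= (2 - l') * (l' - (a' + b')) by apply: mulr_ge0; lra.
have := sqr_ge0 l; have := sqr_ge0 l'; rewrite !expr2.
by lra.
Qed.

Lemma lap_eigen_complement_ge1 (R : realFieldType) (V : finType)
    (G : sgraph V) (x y : V -> R) (l l' : R) (p q p' q' : V) :
  lap_eigen (adj G) x l -> lap_eigen (adj (complement G)) y l' ->
  x p != x q -> y p' != y q' -> 1 <= l + l'.
Proof.
move=> /normalize_range nx /normalize_range ny xpq ypq'.
have {nx xpq} [x' [v [w [ex xvw]]]] := nx _ _ xpq.
have {ny ypq'} [y' [v' [w' [ey yvw]]]] := ny _ _ ypq'.
have l0 := extremes_ge0 ex xvw.
have l'0 := extremes_ge0 ey yvw.
rewrite leNgt; apply/negP => ll'.
have vwN : ~~ adj G v w.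
  apply/negP => vw; have := extremes_ge1 ex xvw (or_introl vw).
  by lra.
have Nvw c : ~~ (adj G v c && adj G w c).
  apply/negP => vc.
  have := extremes_ge1 ex xvw (or_intror (ex_intro _ c vc)).
  by lra.
have v'w'N : ~~ adj (complement G) v' w'.
  apply/negP => vw; have := extremes_ge1 ey yvw (or_introl vw).
  by lra.
have Nv'w' c : ~~ (adj (complement G) v' c && adj (complement G) w' c).
  apply/negP => vc.
  have := extremes_ge1 ey yvw (or_intror (ex_intro _ c vc)).
  by lra.
have [vv'|vv'N] := boolP (adj G v v').
  by have := lap_eigen_path4 ex ey xvw yvw vwN Nvw v'w'N Nv'w' vv'; lra.
have v'w' : adj G v' w'.
  have [yv yw _] := yvw; move: v'w'N; rewrite /= /compl_adj.
  suff -> : v' != w' by rewrite negbK.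
  by apply: contraNneq (oner_neq0 R) => E; rewrite -yv E yw.
(* As [v] is not a common neighbour of [v'] and [w'] in the complement, it meets [w'] in [G];
   replacing [y] by [1 - y] then exchanges [v'] and [w']. *)
have vw' : adj G v w'.
  have := Nv'w' v; rewrite /= /compl_adj !(adj_sym G _ v) (negbTE vv'N) andbT.
  have [<-|_] := eqVneq v' v; first by rewrite v'w'.
  have [E|_] /= := eqVneq w' v; last by rewrite negbK.
  by move: vv'N; rewrite -E adj_sym v'w'.
have w'v'N : ~~ adj (complement G) w' v' by rewrite adj_sym.
have Nw'v' c : ~~ (adj (complement G) w' c && adj (complement G) v' c).
  by rewrite andbC.
have := lap_eigen_path4 ex (lap_eigenC 1 ey)
  xvw (unit_rangeC yvw) vwN Nvw w'v'N Nw'v' vw'.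
by lra.
Qed.

(** * Complements, and the passage from functions to matrices *)

(** The two Laplacians add up to that of the complete graph. *)
Lemma lap_complement (R : realFieldType) (V : finType) (G : sgraph V)
    (x : V -> R) (i : V) :
  lap (adj (complement G)) x i = #|V|%:R * x i - \sum_j x j - lap (adj G) x i.
Proof.
rewrite mulr_natl -sumr_const -!sumrB; apply: eq_bigr => j _.
rewrite /= /compl_adj; have [->|_] := eqVneq i j.
  by rewrite !subrr !mul0rn subr0.
by case: (adj G i j); rewrite /= ?mulr1n ?mulr0n ?subr0 ?subrr.
Qed.

Lemma lap_eigen_complement (R : realFieldType) (V : finType) (G : sgraph V)
    (x : V -> R) (l : R) :
  lap_eigen (adj G) x l -> lap_eigen (adj (complement G)) x (#|V|%:R - l).
Proof. by move=> ex i j; rewrite !lap_complement mulrBl -ex; lra. Qed.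

Lemma lap_laplacian (R : realType) (V : finType) (G : sgraph V)
    (z : 'rV[R]_#|V|) (i : V) :
  (z *m laplacian R G) 0 (enum_rank i)
  = lap (adj G) (fun j => z 0 (enum_rank j)) i.
Proof.
rewrite /laplacian mulmxBr mxE /degree_mx mul_mx_diag !mxE enum_rankK.
rewrite /lap (eq_bigr _ (fun j _ => mulrnBl _ _ _)) sumrB; congr (_ - _).
  rewrite /degree cardsE -sum1_card natr_sum mulr_sumr big_mkcond /=.
  by apply: eq_bigr => j _; rewrite unfold_in mulr1 mulrb.
rewrite (reindex (@enum_rank V)) /=; last first.
  by exists enum_val => j _; rewrite ?enum_valK ?enum_rankK.
by apply: eq_bigr => j _; rewrite mxE !enum_rankK adj_sym mulr_natr.
Qed.

(* The eigenspace of [a] has dimension at least its algebraic multiplicity, so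
   it cannot lie in a line when that multiplicity exceeds 1. *)
Lemma eigenspace_not_line (R : rcfType) (n : nat) (A : 'M[R]_n) (a : R)
    (u : 'rV[R]_n) :
  A^T = A -> (1 < count_mem a (eigenvalues A))%N ->
  exists2 z : 'rV_n, z *m A = a *: z & ~~ (z <= u)%MS.
Proof.
move=> symA; pose B := map_mx (real_complex R) A.
have hermB : B \is hermsymmx.
  apply: realsym_hermsym.
    by apply/is_hermitianmxP; rewrite expr0 scale1r map_mx_id // map_trmx symA.
  by apply/mxOverP => i j; rewrite mxE; apply/complex_realP; exists (A i j).
have /orthomx_spectralP := hermitian_normalmx hermB.
set P := spectralmx B; set d := spectral_diag B => eqB.
have uP : P \in unitmx by exact: spectral_unit.
(* Over the complex numbers, the multiplicity of [a] is its number of occurrences on the diagonal of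
   the diagonalized [B]. *)
have -> : count_mem a (eigenvalues A)
    = count_mem a%:C%C [seq d 0 i | i <- enum 'I_n].
  rewrite -[RHS]mu_prod_XsubC big_map big_enum /=.
  have -> : \prod_i ('X - (d 0 i)%:P) = char_poly B.
    rewrite eqB char_poly_conj // char_poly_trig ?diag_mx_is_trig //.
    by apply: eq_bigr => i _; rewrite !mxE eqxx.
  rewrite -map_char_poly (char_poly_eigenvalues symA) rmorph_prod /=.
  under eq_bigr => x _ do rewrite rmorphB /= map_polyX map_polyC /=.
  rewrite -(big_map (real_complex R) xpredT (fun x => 'X - x%:P)).
  rewrite mu_prod_XsubC count_map; apply: eq_count => x /=.
  by rewrite (inj_eq (@complexI R)).
rewrite count_map -size_filter enumT => card_gt1.
have {card_gt1}/card_gt1P[i [k [di dk ik]]] :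
    (1 < #|[pred i | d 0%R i == a%:C%C]|)%N.
  by rewrite cardE /enum_mem; exact: card_gt1.
have [line|/row_subPn[j zu]] := boolP (eigenspace A a <= u)%MS; last first.
  by exists (row j (eigenspace A a)) => //; apply/eigenspaceP/row_sub.
pose f := real_complex R.
(* If the eigenspace lay in the line of [u], the rows [i] and [k] of the invertible [P] would both
   be multiples of [u]. *)
have rowP h : d 0 h = a%:C%C -> exists c, row h P = c *: map_mx f u.
  move=> dh; apply/sub_rVP; apply: submx_trans (_ : eigenspace B (f a) <= _)%MS.
    apply/eigenspaceP; rewrite {1}eqB !mulmxA -row_mul mulmxV // row1.
    by rewrite -rowE row_diag_mx -scalemxAl dh -rowE.
  by rewrite -map_eigenspace map_submx.
have [c rowi] := rowP i (eqP di); have [c' rowk] := rowP k (eqP dk).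
have : (c' *: delta_mx 0 i - c *: delta_mx 0 k : 'rV_n) *m P = 0.
  by rewrite mulmxBl -!scalemxAl -!rowE rowi rowk !scalerA mulrC subrr.
move/(congr1 (mulmx^~ (invmx P))); rewrite mulmxK // mul0mx.
move/matrixP/(_ 0 i); rewrite !mxE !eqxx (negbTE ik) mulr1 mulr0 subr0 => c'0.
move: rowk; rewrite c'0 scale0r rowE => /(congr1 (mulmx^~ (invmx P))).
rewrite mulmxK // mul0mx => /matrixP/(_ 0 k); rewrite !mxE !eqxx => /eqP.
by rewrite oner_eq0.
Qed.

Lemma laplacian_eigen (R : realType) (V : finType) (G : sgraph V)
    (z : 'rV[R]_#|V|) (l : R) :
  z *m laplacian R G = l *: z ->
  lap_eigen (adj G) (fun i => z 0 (enum_rank i)) l.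
Proof. by move=> ez i j; rewrite -!lap_laplacian ez !mxE mulrBr. Qed.

Lemma nonconstant_rV (F : fieldType) (n : nat) (z : 'rV[F]_n) :
  ~~ (z <= (const_mx 1 : 'rV_n))%MS -> exists i j, z 0 i != z 0 j.
Proof.
have [/existsP[i /existsP[j zij]] _|] :=
  boolP [exists i, exists j, z 0 i != z 0 j].
  by exists i, j.
move=> /existsPn cz /negP[]; case: n z cz => [|n] z cz.
  by rewrite thinmx0 sub0mx.
apply/sub_rVP; exists (z 0 0); apply/rowP => j; rewrite !mxE mulr1.
by have /existsPn/(_ 0) := cz j; rewrite negbK => /eqP.
Qed.

(** * The Laplacian spectrum and nonconstant eigenvectors *)

Section Spectrum.
Variables (R : realType) (V : finType) (G : sgraph V).
Let s := eigenvalues (laplacian R G).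

(** The Laplacian kills constants, so a constant eigenvector forces [l = 0]. *)
Lemma mem_laplacian_eigen l : l \in s ->
  l = 0 \/ exists x p q, lap_eigen (adj G) x l /\ x p != x q.
Proof.
move=> ls.
have : eigenvalue (laplacian R G) l.
  rewrite eigenvalue_root_char (char_poly_eigenvalues (laplacian_sym R G)).
  by rewrite root_prod_XsubC.
case/eigenvalueP => z ez z0.
have [const|/nonconstant_rV[i [j zij]]] :=
  boolP (z <= (const_mx 1 : 'rV_#|V|))%MS.
  left; case/sub_rVP: const => c zc.
  have /rV0Pn[i zi] := z0.
  have : (z *m laplacian R G) 0 (enum_rank (enum_val i)) = 0.
    rewrite lap_laplacian /lap big1 // => j _.
    by rewrite zc !mxE subrr mul0rn.
  rewrite enum_valK ez mxE => /eqP.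
  by rewrite mulf_eq0 (negbTE zi) orbF => /eqP.
right; exists (fun i => z 0 (enum_rank i)), (enum_val i), (enum_val j).
by split; [exact: laplacian_eigen|rewrite !enum_valK].
Qed.

Lemma laplacian_eigenvalue_ge0 l : l \in s -> 0 <= l.
Proof.
case/mem_laplacian_eigen=> [->|[x [p [q [ex xpq]]]]]; first by [].
have [y [v [w [ey yvw]]]] := normalize_range ex xpq.
exact: extremes_ge0 ey yvw.
Qed.

Lemma size_laplacian_eigenvalues : size s = #|V|.
Proof. exact/size_eigenvalues/laplacian_sym. Qed.

Hypothesis V_gt1 : (1 < #|V|)%N.

(** Two vertices put the index [#|V|.-1.-1] inside the list, so the default 0 of [nth] is not
    read. *)
Lemma alpha_mem : alpha R G \in s.
Proof.
by rewrite mem_nth // size_laplacian_eigenvalues -subn2 -subn_gt0 subKn.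
Qed.

Lemma beta_mem : beta R G \in s.
Proof. by rewrite mem_nth // size_laplacian_eigenvalues ltnW. Qed.

(** Only [alpha R G = 0] is in doubt. The last entry of [s] is then 0 too, so 0 is a multiple
    eigenvalue and its eigenspace exceeds the line of constants. *)
Lemma alpha_eigen :
  exists x p q, lap_eigen (adj G) x (alpha R G) /\ x p != x q.
Proof.
have [a0|//] := mem_laplacian_eigen alpha_mem.
have szs := size_laplacian_eigenvalues.
have [n Vn] : exists n, #|V| = n.+2.
  by exists (#|V| - 2)%N; rewrite -addn2 subnK.
have sn : s`_n = 0 by rewrite -[RHS]a0 (_ : n = #|V|.-1.-1); [|rewrite Vn].
have sn1 : s`_n.+1 = 0.
  apply/eqP; rewrite eq_le laplacian_eigenvalue_ge0 ?mem_nth ?szs ?Vn // andbT.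
  have ge_tr : transitive (>=%R : rel R).
    by move=> y x z yx zy; exact: le_trans zy yx.
  have s_sorted : sorted >=%R s by apply: sort_sorted => y z; exact: le_total.
  rewrite -[X in _ <= X]sn; apply: (sorted_leq_nth ge_tr lexx 0 s_sorted) => //.
    by rewrite inE szs Vn.
  by rewrite inE szs Vn.
have s0 : (1 < count_mem 0%R s)%N.
  rewrite -(cat_take_drop n s) (drop_nth 0) ?szs ?Vn //.
  rewrite (drop_nth 0) ?szs ?Vn // sn sn1 count_cat /= eqxx.
  by rewrite !addnS !ltnS.
have [z ez zN] := eigenspace_not_line (const_mx 1) (laplacian_sym R G) s0.
have [i [j zij]] := nonconstant_rV zN; rewrite a0.
exists (fun i => z 0 (enum_rank i)), (enum_val i), (enum_val j).
by split; [exact: laplacian_eigen|rewrite !enum_valK].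
Qed.

End Spectrum.

Unset Implicit Arguments.
Set Strict Implicit.

Theorem corollary3p4 (R : realType) (V : finType) (n : nat) (hV : #|V| = n)
    (hn : (2 <= n)%N) (G : sgraph V) :
  1 <= alpha R G + alpha R (complement G)
  /\ beta R G - alpha R G <= n%:R - 1.
Proof.
have V_gt1 : (1 < #|V|)%N by rewrite hV.
have [x [p [q [ex xpq]]]] := alpha_eigen R G V_gt1.
have [y [p' [q' [ey ypq']]]] := alpha_eigen R (complement G) V_gt1.
split; first exact: lap_eigen_complement_ge1 ex ey xpq ypq'.
have [->|[z [r [t [ez zrt]]]]] := mem_laplacian_eigen (beta_mem R G V_gt1).
  have := laplacian_eigenvalue_ge0 (alpha_mem R G V_gt1).
  have : 1 <= n%:R :> R by rewrite ler1n ltnW.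
  by lra.
(* In the complement, [z] has eigenvalue [#|V|%:R - beta R G]; pairing it with [alpha R G] gives the
   second inequality. *)
have := lap_eigen_complement_ge1 ex (lap_eigen_complement ez) xpq zrt.
by rewrite hV; lra.
Qed.
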